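(* There are no non-trivial bounded uniformly equicontinuous actions of a Lévy group on a metric space having the property ($\lozenge$). That is, if a Lévy group $G$ acts on a metric space $X$ having the property ($\lozenge$) and the action is bounded and uniformly equicontinuous, then $gx=x$ for all $g\in G$ and $x\in X$.
   Context: An mm-space is a complete separable metric space $(X,d_X)$ with a finite Borel measure $\mu_X$; put $m_X:=\mu_X(X)$. For a finite Borel measure $\nu$ on a metric space $Y$ with $m=\nu(Y)$ and $\kappa>0$, $\operatorname{diam}(\nu,m-\kappa):=\inf\{\operatorname{diam}Y_0\mid Y_0\subseteq Y \text{ Borel},\ \nu(Y_0)\geq m-\kappa\}$. For an mm-space $X$, a metric space $Y$ and $\kappa>0$, $\operatorname{ObsDiam}_Y(X;-\kappa):=\sup\{\operatorname{diam}(f_*(\mu_X),m_X-\kappa)\mid f:X\to Y \text{ is } 1\text{-Lipschitz}\}$. A sequence $\{X_n\}$ of mm-spaces is a Lévy family if $\lim_{n\to\infty}\operatorname{ObsDiam}_{\mathbb{R}}(X_n;-\kappa)=0$ for every $\kappa>0$. A metrizable group $G$ is a Lévy group if it contains an increasing chain of compact subgroups $G_1\subseteq G_2\subseteq\cdots$ with everywhere dense union in $G$ such that, for some right-invariant compatible distance function $d_G$ on $G$, the groups $G_n$, equipped with the normalized Haar measures $\mu_{G_n}$ ($\mu_{G_n}(G_n)=1$) and the restrictions of $d_G$, form a Lévy family. An action of a topological group $G$ on a metric space $X$ is bounded if for any $\varepsilon>0$ there is a neighbourhood $U$ of the identity $e_G$ such that $d_X(x,gx)<\varepsilon$ for all $g\in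 U$ and $x\in X$. It is uniformly equicontinuous if for any $\varepsilon>0$ there is $\delta>0$ such that $d_X(gx,gy)<\varepsilon$ for every $g\in G$ and all $x,y\in X$ with $d_X(x,y)<\delta$. A metric space $X$ has the property ($\lozenge$) if $\lim_{n\to\infty}\operatorname{ObsDiam}_X(X_n;-\kappa)=0$ for any $\kappa>0$ and any Lévy family $\{X_n\}_{n=1}^\infty$. *)

(* Defs.v *)
From HB Require Import structures.
From mathcomp Require Import all_boot all_order all_algebra.
From mathcomp Require Import all_classical all_reals all_analysis.

Set Implicit Arguments.
Unset Strict Implicit.
Unset Printing Implicit Defensive.

Import Order.TTheory GRing.Theory Num.Theory.
Import numFieldNormedType.Exports.

Local Open Scope classical_set_scope.
Local Open Scope ring_scope.

#[short(type="completeMetricType")]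
HB.structure Definition CompleteMetric (K : numDomainType) :=
  { M of Metric K M & Complete M }.

Definition separable (T : topologicalType) : Prop :=
  exists2 D : set T, countable D & dense D.

Notation borel T := (g_sigma_algebraType (@open T)).

(* [Complete] includes a base point, so the empty space is left out; as its
   observable diameters are all 0, this affects no Levy family below. *)
Record mmSpace (R : realType) := MMSpace {
  mm_carrier :> completeMetricType R ;
  mm_separable : separable mm_carrier ;
  mm_measure : {finite_measure set (borel mm_carrier) -> \bar R} }.

Definition mm_mass (R : realType) (X : mmSpace R) : \bar R :=
  mm_measure X [set: X].

(* Supremum in [0, +oo]: inserting 0 only changes the supremum of the empty
   family, which is -oo for [ereal_sup]. *)
Definition sup_ge0 (R : realType) (A : set (\bar R)) : \bar R :=
  ereal_sup (0%E |` A).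

Definition diam (R : realType) (Y : metricType R) (A : set Y) : \bar R :=
  sup_ge0 [set (mdist p.1 p.2)%:E | p in A `*` A].

Definition partial_diam (R : realType) (Y : metricType R)
    (nu : set Y -> \bar R) (a : \bar R) : \bar R :=
  ereal_inf [set diam Y0 | Y0 in [set Y0 | <<s open >> Y0 /\ (a <= nu Y0)%E]].

Definition lipschitz1 (R : realType) (X Y : metricType R) (f : X -> Y) : Prop :=
  forall x y, mdist (f x) (f y) <= mdist x y.

(* The push-forward is written out as a set function, since [pushforward] would
   need a base point in [Y]. *)
Definition obs_diam (R : realType) (Y : metricType R) (X : mmSpace R)
    (kappa : R) : \bar R :=
  sup_ge0 [set partial_diam (fun A : set Y => mm_measure X (f @^-1` A))
                            (mm_mass X - kappa%:E)%E
          | f in [set f : X -> Y | lipschitz1 f]].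

Definition levy_family (R : realType) (X : nat -> mmSpace R) : Prop :=
  forall kappa : R, 0 < kappa ->
    obs_diam (R^o : metricType R) (X n) kappa @[n --> \oo] --> 0%E.

Definition lozenge (R : realType) (Y : metricType R) : Prop :=
  forall kappa : R, 0 < kappa -> forall X : nat -> mmSpace R, levy_family X ->
    obs_diam Y (X n) kappa @[n --> \oo] --> 0%E.

HB.mixin Record isTopologicalGroup G & Topological G & Group G := {
  mulg_continuous : continuous (fun x : G * G => (x.1 * x.2)%g) ;
  invg_continuous : continuous (fun x : G => (x^-1)%g) }.

#[short(type="topologicalGroupType")]
HB.structure Definition TopologicalGroup :=
  { G of Topological G & Group G & isTopologicalGroup G }.

Record compatible_dist (R : realType) (T : topologicalType) := CompatibleDist {
  cdist :> T -> T -> R ;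
  cdistxx : forall x, cdist x x = 0 ;
  cdist_positivity : forall x y, cdist x y = 0 -> x = y ;
  cdist_sym : forall x y, cdist x y = cdist y x ;
  cdist_triangle : forall y x z, cdist x z <= cdist x y + cdist y z ;
  cdist_nbhs : forall x,
    nbhs x = filter_from [set e : R | 0 < e] (fun e => [set y | cdist x y < e]) }.

Definition right_invariant (R : realType) (G : topologicalGroupType)
    (d : compatible_dist R G) : Prop :=
  forall x y z : G, d (x * z)%g (y * z)%g = d x y.

Record compact_subgroup (G : topologicalGroupType) := CompactSubgroup {
  csg_set :> set G ;
  csg1 : csg_set 1%g ;
  csgM : forall x y, csg_set x -> csg_set y -> csg_set (x * y)%g ;
  csgV : forall x, csg_set x -> csg_set (x^-1)%g ;
  csg_compact : compact csg_set }.

(* The elements of [H], with the group structure of [H] and, as metric, the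
   restriction of [d]. *)
Definition csg_type (R : realType) (G : topologicalGroupType)
  (d : compatible_dist R G) (H : compact_subgroup G) : Type := set_type H.

Section CompactSubgroup.
Context (R : realType) (G : topologicalGroupType) (d : compatible_dist R G).
Variable H : compact_subgroup G.
Local Notation S := (csg_type d H).

HB.instance Definition _ := Choice.on S.

Definition csg_val (x : S) : G := \val x.

Lemma csg_valP (x : S) : csg_set H (csg_val x).
Proof. exact: set_valP. Qed.

Lemma csg_val_inj : injective csg_val.
Proof. exact: val_inj. Qed.

Definition csg_elt (x : G) (Hx : csg_set H x) : S := SigSub (mem_set Hx).

Definition csg_mul (x y : S) : S := csg_elt (csgM (csg_valP x) (csg_valP y)).
Definition csg_inv (x : S) : S := csg_elt (csgV (csg_valP x)).
Definition csg_one : S := csg_elt (csg1 H).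

Let mulA : associative csg_mul.
Proof. by move=> x y z; apply: csg_val_inj; exact: mulgA. Qed.
Let mul1 : left_id csg_one csg_mul.
Proof. by move=> x; apply: csg_val_inj; exact: mul1g. Qed.
Let mulr1 : right_id csg_one csg_mul.
Proof. by move=> x; apply: csg_val_inj; exact: mulg1. Qed.
Let mulV : left_inverse csg_one csg_inv csg_mul.
Proof. by move=> x; apply: csg_val_inj; exact: mulVg. Qed.
Let mulrV : right_inverse csg_one csg_inv csg_mul.
Proof. by move=> x; apply: csg_val_inj; exact: mulgV. Qed.

HB.instance Definition _ := isGroup.Build S mulA mul1 mulr1 mulV mulrV.

Definition csg_dist (x y : S) : R := d (csg_val x) (csg_val y).

Let distxx x : csg_dist x x = 0. Proof. exact: cdistxx. Qed.
Let dist_positivity x y : csg_dist x y = 0 -> x = y.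
Proof. by move=> /cdist_positivity /csg_val_inj. Qed.
Let dist_sym x y : csg_dist x y = csg_dist y x.
Proof. exact: cdist_sym. Qed.
Let dist_triangle y x z : csg_dist x z <= csg_dist x y + csg_dist y z.
Proof. exact: cdist_triangle. Qed.

HB.instance Definition _ :=
  isMetric.Build R S distxx dist_positivity dist_sym dist_triangle.
HB.instance Definition _ := isPointed.Build S csg_one.

Lemma csg_type_compact : compact [set: S].
Proof.
move=> F FF _.
have FH : (csg_val @ F) (csg_set H).
  by rewrite /= /fmap /=; apply: filterS filterT => x _; exact: csg_valP.
have [p [Hp clp]] := @csg_compact G H _ (fmap_proper_filter csg_val FF) FH.
exists (csg_elt Hp); split => // B N FB /nbhs_ballP[e /= e0 eN].
have Np : nbhs p [set y | d p y < e] by rewrite (cdist_nbhs d); exists e.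
have FvB : (csg_val @ F) (csg_val @` B).
  by rewrite /= /fmap /=; apply: filterS FB => x Bx; exists x.
have [_ [[x Bx <-] px]] := clp _ _ FvB Np.
by exists x; split => //; apply: eN; rewrite ballEmdist.
Qed.

Let cauchy_cvg (F : set_system S) : ProperFilter F -> cauchy F -> cvg F.
Proof.
move=> FF cF; apply: compact_cauchy_cvg cF _ csg_type_compact; exact: filterT.
Qed.

HB.instance Definition _ := Uniform_isComplete.Build S cauchy_cvg.

Lemma csg_type_separable : separable S.
Proof.
have [B cB [_ Bbasis]] := @compact_second_countable R S csg_type_compact.
exists (xget (1%g : S) @` B).
  exact: (sub_countable (card_image_le _ _) cB).
move=> O [x Ox] oO.
have [V [BV Vx VO]] := Bbasis x O (open_nbhs_nbhs (conj oO Ox)).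
exists (xget (1%g : S) V); split; last by exists V.
by apply: VO; apply: xgetPex; exists x.
Qed.

End CompactSubgroup.

(* On a compact group, left-invariance and total mass 1 determine the measure. *)
Definition normalized_haar (R : realType) (G : topologicalGroupType)
    (d : compatible_dist R G) (H : compact_subgroup G)
    (mu : probability (borel (csg_type d H)) R) : Prop :=
  forall (g : csg_type d H) (A : set (borel (csg_type d H))), measurable A ->
    mu [set (g * x)%g | x in A] = mu A.

Definition csg_mmSpace (R : realType) (G : topologicalGroupType)
    (d : compatible_dist R G) (H : compact_subgroup G)
    (mu : probability (borel (csg_type d H)) R) : mmSpace R :=
  @MMSpace R (csg_type d H) (csg_type_separable d H) mu.

(* Metrizability of [G] is part of the existence of [d]. *)
Definition levy_group (R : realType) (G : topologicalGroupType) : Prop :=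
  exists H : nat -> compact_subgroup G,
    [/\ forall n, H n `<=` H n.+1,
        dense (\bigcup_n (H n : set G)) &
        exists2 d : compatible_dist R G, right_invariant d &
          exists2 mu : forall n, probability (borel (csg_type d (H n))) R,
            forall n, normalized_haar (mu n) &
            levy_family (fun n => csg_mmSpace (mu n))].

Definition is_group_action (G : groupType) (X : Type) (act : G -> X -> X) :=
  (forall x, act 1%g x = x) /\
  (forall g h x, act (g * h)%g x = act g (act h x)).

Definition bounded_action (R : realType) (G : topologicalGroupType)
    (X : metricType R) (act : G -> X -> X) : Prop :=
  forall e : R, 0 < e -> exists2 U : set G, nbhs (1%g : G) U &
    forall g x, U g -> mdist x (act g x) < e.

Definition unif_equicontinuous_action (R : realType) (G : groupType)
    (X : metricType R) (act : G -> X -> X) : Prop :=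
  forall e : R, 0 < e -> exists2 delta : R, 0 < delta &
    forall g x y, mdist x y < delta -> mdist (act g x) (act g y) < e.

(* Main.v *)
(** For [x] in [X] the maps [g |-> g^-1 x] on the subgroups [G_n] are uniformly
    continuous, uniformly in [n]. Given such maps [f_n] on a Levy family, adding
    to the distance of the [n]-th space the pull-back [mdist (f_n a) (f_n b)]
    makes every [f_n] 1-Lipschitz, and the family remains Levy, since
    concentration around an approximate median holds for uniformly continuous
    functions as well. Hence property (lozenge) gives a set [Y0] of small
    diameter such that [A = {g | g^-1 x in Y0}] has measure close to 1. By
    left invariance of the Haar measure, [A] meets its translate [h A], so
    [g^-1 x] and [g^-1 h^-1 x] are close for some [g]; by equicontinuity [x] and
    [h^-1 x] are close. As [h] lies in all [G_m] with
    [m >= n], it fixes [x], and density of the union concludes. *)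
From HB Require Import structures.
Require Import Defs.
From mathcomp Require Import all_boot all_order all_algebra.
From mathcomp Require Import all_classical all_reals all_analysis.
From mathcomp Require Import lra.

Set Implicit Arguments.
Unset Strict Implicit.
Unset Printing Implicit Defensive.

Import Order.TTheory GRing.Theory Num.Theory.
Import numFieldNormedType.Exports.

Local Open Scope classical_set_scope.
Local Open Scope ring_scope.

(** * Uniform continuity in metric terms, and preimages of Borel sets *)

Definition modulus_at (R : realType) (X Y : metricType R) (f : X -> Y)
    (e delta : R) : Prop :=
  forall x y, mdist x y < delta -> mdist (f x) (f y) < e.

Definition mdist_unif_continuous (R : realType) (X Y : metricType R)
    (f : X -> Y) : Prop :=
  forall e : R, 0 < e -> exists2 delta : R, 0 < delta & modulus_at f e delta.

Lemma nbhs_mdistP (R : realType) (X : metricType R) (x : X) (A : set X) :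
  nbhs x A <-> exists2 e : R, 0 < e & forall y, mdist x y < e -> A y.
Proof.
rewrite -nbhs_ballE; split=> -[e /= e0 eA]; exists e => // y.
  by move=> xy; apply: eA; rewrite ballEmdist.
by rewrite ballEmdist; exact: eA.
Qed.

Lemma mdist_unif_continuous_continuous (R : realType) (X Y : metricType R)
  (f : X -> Y) : mdist_unif_continuous f -> continuous f.
Proof.
move=> fu x A /nbhs_mdistP[e e0 eA].
have [delta delta0 fdelta] := fu e e0.
by apply/nbhs_mdistP; exists delta => // y /fdelta; exact: eA.
Qed.

(** The sets with measurable preimage form a sigma-algebra containing the open sets. Borel sets of
    [Y] are written [<<s open >>] because [Y] need not be pointed. *)
Lemma borel_preimage (T : ptopologicalType) (Y : topologicalType) (f : T -> Y)
    (A : set Y) :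
  continuous f -> <<s open >> A -> measurable (f @^-1` A : set (borel T)).
Proof.
move=> /continuousP fc; move: A; apply: smallest_sub; last first.
  by move=> A oA; apply: sub_sigma_algebra; exact: fc.
split.
- by rewrite /= preimage_set0; exact: measurable0.
- move=> A mA; rewrite /= setTD preimage_setC; exact: measurableC.
- by move=> F mF; rewrite /= preimage_bigcup; exact: bigcupT_measurable.
Qed.

(** * Finite measures: overlap of large sets, approximate medians *)

Section FiniteMeasure.
Context d (T : measurableType d) (R : realType).
Variable mu : {finite_measure set T -> \bar R}.
Implicit Types A B : set T.

Lemma measure_add_le A B : measurable A -> measurable B ->
  (mu A + mu B <= mu setT + mu (A `&` B))%E.
Proof.
move=> mA mB; rewrite (measureDI mu mA mB) addeAC leeD2r//.
rewrite addeC -measureU//; first last.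
- by rewrite setDE setICA setICr setI0.
- exact: measurableD.
apply: le_measure; rewrite ?inE//.
by apply: measurableU => //; exact: measurableD.
Qed.

Lemma measure_meet A B : measurable A -> measurable B ->
  (mu setT < mu A + mu B)%E -> A `&` B !=set0.
Proof.
move=> mA mB AB; apply/set0P/eqP => AB0.
by have := measure_add_le mA mB; rewrite AB0 measure0 adde0 leNgt AB.
Qed.

Lemma measure_nondecreasing_gt (F : (set T)^nat) (c : \bar R) :
  (forall n, measurable (F n)) -> nondecreasing_seq F -> \bigcup_n F n = setT ->
  (c < mu setT)%E -> exists n, (c < mu (F n))%E.
Proof.
move=> mF ndF FT; apply: contraPP => /forallNP ct; apply/negP; rewrite -leNgt.
have := nondecreasing_cvg_mu (mu := mu) mF (bigcupT_measurable F mF) ndF.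
rewrite FT => /cvg_lim <-//; apply: lime_le.
  apply: ereal_nondecreasing_is_cvgn => m n mn.
  by apply: le_measure; rewrite ?inE//; exact/subsetPset/ndF.
by near=> n; rewrite /= leNgt; apply/negP/ct.
Unshelve. all: by end_near. Qed.

(** The witness is the infimum of the levels whose sublevel set has at least half of the mass.
    Thanks to the slack [e] on both sides, it does not matter whether this infimum is attained. *)
Lemma exists_approx_median (phi : T -> R) (e : R) :
  (forall t, measurable [set x | phi x <= t]) ->
  0 < e -> (0 < mu setT)%E ->
  exists t, (mu setT <= 2%:E * mu [set x | (phi x <= t + e)%R])%E /\
            (mu setT <= 2%:E * mu (~` [set x | (phi x <= t - e)%R]))%E.
Proof.
move=> mphi e0 mu0.
pose L t := [set x | phi x <= t].
have mL t : measurable (L t) by exact: mphi.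
have mLC t : measurable (~` L t) by exact: measurableC.
have LS s t : s <= t -> L s `<=` L t by move=> st x /le_trans; apply.
have muLE A : measurable A -> mu A = (fine (mu A))%:E.
  by move=> mA; rewrite fineK// fin_num_measure.
have muT := muLE _ measurableT.
pose M := fine (mu setT).
have M0 : 0 < M by rewrite -lte_fin -muT.
have cM : ((M / 2)%:E < mu setT)%E by rewrite muT lte_fin -/M; lra.
have muC t : fine (mu (L t)) + fine (mu (~` L t)) = M.
  apply: EFin_inj; rewrite EFinD -!muLE// -measureU// ?setUv//.
  exact: setICr.
pose S := [set t | M / 2 <= fine (mu (L t))].
have S0 : S !=set0.
  have [|||n] := measure_nondecreasing_gt (F := fun n => L n%:R) _ _ _ cM.
  - by move=> n; exact: mL.
  - by move=> m n mn; apply/subsetPset/LS; rewrite ler_nat.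
  - apply/seteqP; split=> // x _; exists (Num.truncn `|phi x|).+1 => //.
    by rewrite /L/=; apply: (le_trans (ler_norm _)); exact/ltW/truncnS_gt.
  - by rewrite (muLE (L _))// lte_fin => /ltW ?; exists n%:R.
(* Once the complement of [L (- n%:R)] carries more than half of the mass, monotonicity of [L] keeps
   every level below [- n%:R] out of [S]. *)
have Slb : has_lbound S.
  have [|||n] :=
      measure_nondecreasing_gt (F := fun n => ~` L (- n%:R)) _ _ _ cM.
  - by move=> n; exact: mLC.
  - by move=> m n mn; apply/subsetPset/subsetC/LS; rewrite lerN2 ler_nat.
  - apply/seteqP; split=> // x _; exists (Num.truncn `|phi x|).+1 => //.
    rewrite /L/= => xn.
    have := truncnS_gt `|phi x|; rewrite ltNge => /negP; apply.
    by have := ler_norm (- phi x); rewrite normrN; lra.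
  rewrite (muLE (~` L _))// lte_fin => nM; exists (- n%:R) => t St.
  rewrite leNgt; apply/negP => tn.
  have : fine (mu (L t)) <= fine (mu (L (- n%:R))).
    by rewrite fine_le ?fin_num_measure// le_measure ?inE//; exact/LS/ltW.
  have := muC (- n%:R); rewrite /S/= in St *; lra.
have [t St te] := inf_adherent e0 (conj S0 Slb).
(* The level [t] of [S] below [inf S + e] gives the first bound; [inf S - e] lies outside [S], which
   gives the second. *)
exists (inf S); rewrite -/(L _) -/(L (inf S - e)) muT -/M; split.
  rewrite (muLE (L _))// -EFinM lee_fin.
  have : fine (mu (L t)) <= fine (mu (L (inf S + e))).
    by rewrite fine_le ?fin_num_measure// le_measure ?inE//; exact/LS/ltW.
  rewrite /S/= in St *; lra.
rewrite (muLE (~` L _))// -EFinM lee_fin.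
have : fine (mu (L (inf S - e))) < M / 2.
  rewrite ltNge; apply/negP => SS; have := ge_inf Slb SS; lra.
have := muC (inf S - e); lra.
Qed.

End FiniteMeasure.

(** * Change of metric that makes a uniformly continuous map 1-Lipschitz *)

Section GraphMetric.
Context (R : realType) (T : completeMetricType R) (Y : metricType R).
Context (f : T -> Y) (fu : mdist_unif_continuous f).

(** An alias of [T], indexed by the proof about [f], so that a second metric can be declared beside
    that of [T]. *)
Definition graph_type of mdist_unif_continuous f : Type := T.
Local Notation S := (graph_type fu).

HB.instance Definition _ := Choice.on S.
HB.instance Definition _ := Pointed.on S.

(** The distance inherited from the graph of [f] in the product of [T] and [Y] with the sum
    distance. *)
Definition graph_dist (x y : S) : R :=
  mdist (x : T) (y : T) + mdist (f x) (f y).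

Let distxx x : graph_dist x x = 0.
Proof. by rewrite /graph_dist !mdistxx addr0. Qed.
Let dist_positivity x y : graph_dist x y = 0 -> x = y.
Proof.
move=> /eqP; rewrite /graph_dist paddr_eq0 ?mdist_ge0// => /andP[/eqP + _].
exact: mdist_positivity.
Qed.
Let dist_sym x y : graph_dist x y = graph_dist y x.
Proof. by congr (_ + _); rewrite metric_sym. Qed.
Let dist_triangle y x z : graph_dist x z <= graph_dist x y + graph_dist y z.
Proof. by rewrite /graph_dist addrACA lerD// metric_triangle. Qed.

HB.instance Definition _ :=
  isMetric.Build R S distxx dist_positivity dist_sym dist_triangle.

Definition to_graph (x : T) : S := x.

Definition of_graph (x : S) : T := x.

Lemma mdist_graph (x y : S) :
  mdist x y = mdist (of_graph x) (of_graph y) + mdist (f x) (f y).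
Proof. by []. Qed.

(** Uniform continuity of [f] enters here. With [of_graph_lipschitz] it makes the two distances
    uniformly equivalent, so completeness and separability carry over from [T]. *)
Lemma to_graph_unif_continuous : mdist_unif_continuous to_graph.
Proof.
move=> e e0; have e20 : 0 < e / 2 by rewrite divr_gt0.
have [delta delta0 fdelta] := fu e20.
exists (Num.min delta (e / 2)); first by rewrite lt_min delta0.
move=> x y; rewrite lt_min mdist_graph => /andP[/fdelta fxy xy].
by rewrite (splitr e) ltrD.
Qed.

Lemma to_graph_continuous : continuous to_graph.
Proof. exact/mdist_unif_continuous_continuous/to_graph_unif_continuous. Qed.

Lemma of_graph_lipschitz : lipschitz1 of_graph.
Proof. by move=> x y; rewrite mdist_graph lerDl mdist_ge0. Qed.

Lemma graph_lipschitz : lipschitz1 (f \o of_graph).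
Proof. by move=> x y; rewrite mdist_graph lerDr mdist_ge0. Qed.

Let cauchy_cvg (F : set_system S) : ProperFilter F -> cauchy F -> cvg F.
Proof.
move=> FF /cauchy_ballP cF.
have cT : cauchy (of_graph @ F).
  apply/cauchy_ballP => e e0; near_simpl; have := cF e e0; near_simpl.
  apply: filterS => -[x y] /=; rewrite !ballEmdist; apply: le_lt_trans.
  exact: of_graph_lipschitz.
have /cvg_ex[p Fp] : cvg (of_graph @ F) by exact: cauchy_cvg cT.
apply/cvg_ex; exists (to_graph p).
by have := cvg_comp of_graph to_graph Fp (to_graph_continuous (x := p)).
Unshelve. all: by end_near. Qed.

HB.instance Definition _ := Uniform_isComplete.Build S cauchy_cvg.

Lemma graph_separable : separable T -> separable S.
Proof.
move=> [D cD dD]; exists (to_graph @` D).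
  exact: (sub_countable (card_image_le _ _) cD).
move=> O [x Ox] oO.
have oO' : open (to_graph @^-1` O).
  by have /continuousP := to_graph_continuous; exact.
have [y [Oy Dy]] := dD _ (ex_intro _ (of_graph x) Ox) oO'.
by exists (to_graph y); split => //; exists y.
Qed.

Variable mu : {finite_measure set (borel T) -> \bar R}.

Let to_graph_measurable :
  measurable_fun [set: borel T] (to_graph : borel T -> borel S).
Proof.
move=> _ A mA; rewrite setTI.
exact: borel_preimage to_graph_continuous mA.
Qed.

(** The measure [mu] itself, carried to the Borel sets of the new metric along the identity. *)
Definition graph_measure (A : set (borel S)) : \bar R :=
  pushforward mu (to_graph : borel T -> borel S) A.

Let graph_measure0 : graph_measure set0 = 0%E.
Proof. exact: (@measure0 _ _ _ (pushforward mu _)). Qed.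
Let graph_measure_ge0 A : (0 <= graph_measure A)%E.
Proof. exact: (@measure_ge0 _ _ _ (pushforward mu _)). Qed.
Let graph_measure_sigma_additive : semi_sigma_additive graph_measure.
Proof. exact: (@measure_semi_sigma_additive _ _ _ (pushforward mu _)). Qed.

HB.instance Definition _ := isMeasure.Build _ _ _ graph_measure
  graph_measure0 graph_measure_ge0 graph_measure_sigma_additive.

Let graph_measure_finite : fin_num_fun graph_measure.
Proof.
move=> A mA; apply: fin_num_measure.
by rewrite -[X in measurable X]setTI; exact: to_graph_measurable.
Qed.

HB.instance Definition _ := Measure_isFinite.Build _ _ _ graph_measure
  graph_measure_finite.

End GraphMetric.

Definition graph_mmSpace (R : realType) (X : mmSpace R) (Y : metricType R)
    (f : X -> Y) (fu : mdist_unif_continuous f) : mmSpace R :=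
  @MMSpace R (graph_type fu) (graph_separable fu (mm_separable X))
    (graph_measure (fu := fu) (mm_measure X)).

(** * Diameters, distance to a set, and concentration on one space *)

Lemma mdist_realE (R : realType) (x y : R^o) : mdist x y = `|y - x|.
Proof. by []. Qed.

Lemma mdist_le_diam (R : realType) (Y : metricType R) (A : set Y) (x y : Y) :
  A x -> A y -> ((mdist x y)%:E <= diam A)%E.
Proof. by move=> Ax Ay; apply: ereal_sup_ubound; right; exists (x, y). Qed.

Lemma diam_le (R : realType) (Y : metricType R) (A : set Y) (r : R) : 0 <= r ->
  (forall x y, A x -> A y -> mdist x y <= r) -> (diam A <= r%:E)%E.
Proof.
move=> r0 Ar; apply: ge_ereal_sup => _ [->|[[x y] [Ax Ay] <-]].
  by rewrite lee_fin.
rewrite lee_fin; exact: Ar.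
Qed.

Lemma partial_diam_le_obs_diam (R : realType) (Y : metricType R)
    (X : mmSpace R) (kappa : R) (f : X -> Y) : lipschitz1 f ->
  (partial_diam (fun A => mm_measure X (f @^-1` A)) (mm_mass X - kappa%:E)
    <= obs_diam Y X kappa)%E.
Proof. by move=> f1; apply: ereal_sup_ubound; right; exists f. Qed.

Lemma lipschitz1_unif_continuous (R : realType) (X Y : metricType R)
  (f : X -> Y) : lipschitz1 f -> mdist_unif_continuous f.
Proof.
by move=> f1 e e0; exists e => // x y; apply: le_lt_trans; exact: f1.
Qed.

Definition dist_to (R : realType) (X : metricType R) (A : set X) (x : X) : R :=
  inf [set mdist x a | a in A].

Section DistTo.
Context (R : realType) (X : metricType R) (A : set X).

Let dist_to_lb x : has_lbound [set mdist x a | a in A].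
Proof. by exists 0 => _ [a _ <-]; exact: mdist_ge0. Qed.

Lemma dist_to_le x a : A a -> dist_to A x <= mdist x a.
Proof. by move=> Aa; apply: ge_inf => //; exists a. Qed.

Lemma dist_to_ge0 x : A !=set0 -> 0 <= dist_to A x.
Proof.
move=> [a Aa]; apply: lb_le_inf; first by exists (mdist x a), a.
by move=> _ [b _ <-]; exact: mdist_ge0.
Qed.

Lemma dist_to_in a : A a -> dist_to A a = 0.
Proof.
move=> Aa; apply/eqP; rewrite eq_le dist_to_ge0 ?andbT; last by exists a.
by rewrite -(mdistxx a) dist_to_le.
Qed.

Lemma dist_to_lt x e : A !=set0 -> dist_to A x < e ->
  exists2 a, A a & mdist x a < e.
Proof.
move=> [a Aa] /inf_lt[]; first by exists (mdist x a), a.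
by move=> _ [b Ab <-] be; exists b.
Qed.

Lemma dist_to_lipschitz : A !=set0 -> lipschitz1 (dist_to A : X -> R^o).
Proof.
move=> A0.
have le x y : dist_to A x <= mdist x y + dist_to A y.
  rewrite -lerBlDl; apply: lb_le_inf.
    by case: A0 => a Aa; exists (mdist y a), a.
  move=> _ [a Aa <-]; rewrite lerBlDl.
  exact: le_trans (dist_to_le x Aa) (metric_triangle x y a).
move=> x y; rewrite mdist_realE ler_distl; apply/andP; split.
  by rewrite lerBlDl le.
by rewrite metric_sym addrC le.
Qed.

End DistTo.

(** The observable diameter is tested on [dist_to A]: a set [Y0] of diameter below [delta] receives
    all but mass [kappa]. As [A] has more mass than that, its points force 0 into [Y0], so all
    values in [Y0] are below [delta]. *)
Lemma levy_enlargement (R : realType) (X : mmSpace R) (kappa delta : R)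
    (A : set (borel X)) : 0 <= kappa -> measurable A ->
  (kappa%:E < mm_measure X A)%E ->
  (obs_diam (R^o : metricType R) X kappa < delta%:E)%E ->
  exists P : set (borel X), [/\ measurable P,
    (mm_mass X - kappa%:E <= mm_measure X P)%E &
    forall x : X, P x -> exists2 a : X, A a & mdist x a < delta].
Proof.
move=> k0 mA kA oX.
have A0 : A !=set0.
  by apply/set0P/eqP => A0; move: kA; rewrite A0 measure0 lte_fin ltNge k0.
have psi1 := dist_to_lipschitz A0.
have := le_lt_trans (partial_diam_le_obs_diam kappa psi1) oX.
move=> /ereal_inf_lt[_ [Y0 [bY0 kY0] <-] Y0delta].
have mP : measurable ((dist_to A : X -> R^o) @^-1` Y0 : set (borel X)).
  apply: borel_preimage bY0.
  exact/mdist_unif_continuous_continuous/lipschitz1_unif_continuous.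
exists (dist_to A @^-1` Y0); split => // x Px.
have [a [Aa Pa]] : A `&` (dist_to A @^-1` Y0 : set (borel X)) !=set0.
  apply: (measure_meet (mu := mm_measure X) mA mP).
  have mu1 := fin_num_measure (mm_measure X) _ mA.
  have mu2 := fin_num_measure (mm_measure X) _ mP.
  have mu3 := fin_num_measure (mm_measure X) _ measurableT.
  move: kA kY0; rewrite /mm_mass -(fineK mu1) -(fineK mu2) -(fineK mu3).
  rewrite -EFinB -EFinD !lte_fin lee_fin; lra.
apply: (dist_to_lt A0); rewrite -lte_fin; apply: le_lt_trans Y0delta.
have := @mdist_le_diam R R^o Y0 _ _ Pa Px.
rewrite dist_to_in// mdist_realE subr0 ger0_norm//.
by apply: dist_to_ge0; exists a.
Qed.

(** Concentration around an approximate median [t]. Up to mass [kappa / 2] each, points are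
    [delta]-close to a point where [phi] is at most [t + e], and to one where it exceeds [t - e].
    The modulus then puts [phi] within [2 * e] of [t] outside mass [kappa]. *)
Lemma partial_diam_unif_continuous (R : realType) (X : mmSpace R)
    (phi : X -> R^o) (kappa delta e : R) :
  0 < kappa -> 0 < e -> continuous phi -> modulus_at phi e delta ->
  (obs_diam (R^o : metricType R) X (kappa / 2) < delta%:E)%E ->
  (partial_diam (fun A => mm_measure X (phi @^-1` A)) (mm_mass X - kappa%:E)
    <= (4 * e)%:E)%E.
Proof.
move=> k0 e0 phic phie oX.
set mu := mm_measure X.
have muE (A : set (borel X)) : measurable A -> mu A = (fine (mu A))%:E.
  by move=> mA; rewrite fineK// fin_num_measure.
have muT : mm_mass X = (fine (mu setT))%:E by exact: muE.
(* If [kappa] is at least the total mass, the empty set is admissible; otherwise half of the total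
   mass exceeds [kappa / 2]. *)
have [mk|km] := leP (fine (mu setT)) kappa.
  apply: (@le_trans _ _ (diam (set0 : set R^o))).
    apply: ereal_inf_lbound; exists set0 => //; split.
      by apply: sub_sigma_algebra; exact: open0.
    by rewrite preimage_set0 measure0 muT -EFinB lee_fin subr_le0.
  by apply: diam_le => //; rewrite mulr_ge0// ltW.
have closed_meas (A : set R^o) : closed A -> <<s open >> A.
  move=> cA; rewrite -(setCK A).
  have -> : ~` ~` A = setT `\` ~` A by rewrite setTD.
  apply: sigma_algebraCD; apply: sub_sigma_algebra; exact: closed_openC.
have mphi t : measurable ([set x | phi x <= t] : set (borel X)).
  apply: (@borel_preimage _ _ phi [set y : R | y <= t]) => //.
  by apply: closed_meas; exact: closed_le.
have mu0 : (0 < mu setT)%E by rewrite muE// lte_fin (lt_trans k0).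
have [t []] := exists_approx_median mphi e0 mu0.
set A := [set x | _]; set B := ~` _ => muA muB.
have mA : measurable A by exact: mphi.
have mB : measurable B by apply: measurableC; exact: mphi.
have kA : ((kappa / 2)%:E < mu A)%E.
  move: muA; rewrite (muE A)// (muE setT)// -EFinM lee_fin lte_fin; lra.
have kB : ((kappa / 2)%:E < mu B)%E.
  move: muB; rewrite (muE B)// (muE setT)// -EFinM lee_fin lte_fin; lra.
have k20 : 0 <= kappa / 2 by lra.
have [P [mP muP PA]] := levy_enlargement k20 mA kA oX.
have [Q [mQ muQ QB]] := levy_enlargement k20 mB kB oX.
pose I : set R^o := [set y | t - 2 * e <= y <= t + 2 * e].
have bI : <<s open >> I.
  apply: closed_meas.
  have -> : I = [set y | t - 2 * e <= y] `&` [set y | y <= t + 2 * e].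
    by apply/seteqP; split=> y /= /andP.
  by apply: closedI; [exact: closed_ge|exact: closed_le].
apply: (@le_trans _ _ (diam I)); last first.
  apply: diam_le => [|x y]; first by rewrite mulr_ge0// ltW.
  by rewrite /I/= mdist_realE => /andP[? ?] /andP[? ?]; rewrite ler_distl; lra.
apply: ereal_inf_lbound; exists I => //; split => //.
have mI : measurable (phi @^-1` I : set (borel X)) by exact: borel_preimage bI.
have PQI : P `&` Q `<=` phi @^-1` I.
  move=> x [/PA[a Aa xa] /QB[b Bb xb]].
  have := phie _ _ xa; have := phie _ _ xb; rewrite !mdist_realE !ltr_distl.
  move: Aa Bb; rewrite /A /B/= => Aa /negP; rewrite -ltNge => Bb.
  move=> /andP[? ?] /andP[? ?].
  by rewrite /I/=; apply/andP; split; lra.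
have mPQ : measurable (P `&` Q) by exact: measurableI.
apply: (@le_trans _ _ (mu (P `&` Q))); last by apply: le_measure; rewrite ?inE.
have := measure_add_le mu mP mQ; move: muP muQ.
rewrite muT (muE P)// (muE Q)// (muE setT)// (muE (P `&` Q))//.
rewrite -!EFinB -!EFinD !lee_fin /=; lra.
Qed.

(** * Levy families and equi-uniformly continuous maps *)

Lemma cvge0P (R : realType) (u : nat -> \bar R) : (forall n, 0 <= u n)%E ->
  u n @[n --> \oo] --> 0%E <->
  forall e : R, 0 < e -> \forall n \near \oo, (u n < e%:E)%E.
Proof.
move=> u0; split=> [ucvg e e0|ue].
  apply: (ucvg [set y | (y < e%:E)%E]); apply: open_nbhs_nbhs; split.
    exact: open_ereal_lt_ereal.
  by rewrite /= lte_fin.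
apply/fine_cvgP; split.
  apply: filterS (ue 1 ltr01) => n un.
  by rewrite ge0_fin_numE// (lt_trans un)// ltry.
apply/cvgrPdist_lt => e e0; apply: filterS (ue e e0) => n un.
rewrite /= sub0r normrN ger0_norm ?fine_ge0//.
by rewrite -lte_fin fineK// ge0_fin_numE// (lt_trans un)// ltry.
Qed.

Lemma obs_diam_ge0 (R : realType) (Y : metricType R) (X : mmSpace R)
  (kappa : R) : (0 <= obs_diam Y X kappa)%E.
Proof. by apply: ereal_sup_ubound; left. Qed.

Section EquiUnifContinuous.
Context (R : realType) (Y : metricType R) (X : nat -> mmSpace R).
Context (f : forall n, X n -> Y).
Hypothesis levyX : levy_family X.
Hypothesis fequi : forall e : R, 0 < e -> exists2 delta : R, 0 < delta &
  forall n, modulus_at (@f n) e delta.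

Let fu n : mdist_unif_continuous (@f n).
Proof. by move=> e /fequi[delta delta0 fdelta]; exists delta. Qed.

(** A 1-Lipschitz function for the graph distance has, for the original one, a modulus depending
    neither on the function nor on [n]; [partial_diam_unif_continuous] then bounds all of them at
    once. *)
Lemma levy_family_graph : levy_family (fun n => graph_mmSpace (fu n)).
Proof.
move=> kappa k0; apply/cvge0P => [n|e e0]; first exact: obs_diam_ge0.
(* The two summands of the graph distance give oscillation [2 * e'], hence partial diameter at most
   [4 * (2 * e') = e / 2], strictly below [e]. *)
pose e' := e / 16; have e'0 : 0 < e' by rewrite /e'; lra.
have [delta delta0 fdelta] := fequi e'0.
have delta'0 : 0 < Num.min delta e' by rewrite lt_min delta0.
have k20 : 0 < kappa / 2 by lra.
have /cvge0P/(_ _ delta'0) := levyX k20.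
have nneg n : (0 <= obs_diam (R^o : metricType R) (X n) (kappa / 2))%E.
  exact: obs_diam_ge0.
move=> /(_ nneg); apply: filterS => n oX.
apply: (@le_lt_trans _ _ (e / 2)%:E); last by rewrite lte_fin; lra.
apply: ge_ereal_sup => _ [->|[phi phi1 <-]]; first by rewrite lee_fin; lra.
have phic : continuous (phi \o @to_graph _ _ _ _ (fu n)).
  move=> x; apply: continuous_comp; first exact: to_graph_continuous.
  exact/mdist_unif_continuous_continuous/lipschitz1_unif_continuous.
have phie : modulus_at (phi \o @to_graph _ _ _ _ (fu n)) (2 * e')
    (Num.min delta e').
  move=> x y; rewrite lt_min => /andP[/fdelta fxy xy].
  apply: (le_lt_trans (phi1 _ _)); rewrite mdist_graph mulr_natl mulr2n.
  exact: ltrD.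
have e'20 : 0 < 2 * e' by lra.
have := partial_diam_unif_continuous k0 e'20 phic phie oX.
have -> : 4 * (2 * e') = e / 2 by rewrite /e'; lra.
exact.
Qed.

(** Each [f n] is 1-Lipschitz on its graph space, where it has the same push-forward measure, so the
    property applies to the family of graph spaces. *)
Lemma lozenge_equi_unif_continuous (kappa e : R) : lozenge Y ->
  0 < kappa -> 0 < e -> \forall n \near \oo,
  (partial_diam (fun A => mm_measure (X n) (@f n @^-1` A))
    (mm_mass (X n) - kappa%:E) < e%:E)%E.
Proof.
move=> lozY k0 e0; have := lozY _ k0 _ levy_family_graph.
move=> /cvge0P/(_ _ e0) h; apply: filterS (h _) => [n|n]; last first.
  exact: obs_diam_ge0.
apply: le_lt_trans.
exact: (partial_diam_le_obs_diam (X := graph_mmSpace (fu n)) kappa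
  (graph_lipschitz (fu := fu n))).
Qed.

End EquiUnifContinuous.

(** * Inverse orbit maps and fixed points of the action *)

Section OrbitMaps.
Context (R : realType) (G : topologicalGroupType) (X : metricType R).
Context (act : G -> X -> X).
Hypothesis actG : is_group_action act.
Hypothesis actb : bounded_action act.
Hypothesis acte : unif_equicontinuous_action act.
Context (d : compatible_dist R G).
Hypothesis dinv : right_invariant d.

Let act1 x : act 1%g x = x. Proof. exact: actG.1. Qed.
Let actM g h x : act (g * h)%g x = act g (act h x). Proof. exact: actG.2. Qed.

(** Right translation by [h] turns the distance from [g * h^-1] to the identity into [d g h]. *)
Lemma bounded_action_dist e : 0 < e -> exists2 delta, 0 < delta &
  forall g h x, d g h < delta -> mdist x (act (g * h^-1)%g x) < e.
Proof.
move=> /actb[U]; rewrite (cdist_nbhs d) => -[delta /= delta0 dU] Ue.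
exists delta => // g h x gh; apply/Ue/dU => /=.
by rewrite cdist_sym -(dinv _ _ h) mulgVK mul1g.
Qed.

Definition inv_orbit (H : compact_subgroup G) (x : X) (g : csg_type d H) : X :=
  act (csg_val g)^-1%g x.

(* The inverse makes the orbit map uniformly continuous for a right-invariant
   distance while turning left translations of [g] into a change of [x]. *)
Lemma inv_orbit_equi e : 0 < e -> exists2 delta, 0 < delta &
  forall H x, modulus_at (@inv_orbit H x) e delta.
Proof.
move=> /acte[eta eta0 acteta].
have [delta delta0 ddelta] := bounded_action_dist eta0.
exists delta => // H x g h gh; rewrite /inv_orbit.
have -> : ((csg_val h)^-1 = (csg_val g)^-1 * (csg_val g * (csg_val h)^-1))%g.
  by rewrite mulKg.
by rewrite actM; apply/acteta/ddelta.
Qed.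

Lemma inv_orbit_mul (H : compact_subgroup G) (x : X) (g h : csg_type d H) :
  inv_orbit x (g * h)%g = inv_orbit (inv_orbit x g) h.
Proof. by rewrite /inv_orbit -actM -invgM. Qed.

Lemma inv_orbit_continuous H x : continuous (@inv_orbit H x).
Proof.
apply: mdist_unif_continuous_continuous => e.
by move=> /inv_orbit_equi[delta delta0 h]; exists delta.
Qed.

Variable H : nat -> compact_subgroup G.
Variable mu : forall n, probability (borel (csg_type d (H n))) R.
Hypothesis muH : forall n, normalized_haar (mu n).
Hypothesis levyH : levy_family (fun n => csg_mmSpace (mu n)).
Hypothesis lozX : lozenge X.

(** The threshold on [n] is common to all [h], so that an element of an early subgroup can be tested
    in all late ones. *)
Lemma levy_action_almost_fixed (x : X) (e : R) : 0 < e ->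
  \forall n \near \oo, forall h : csg_type d (H n), mdist x (inv_orbit x h) < e.
Proof.
move=> /acte[eta eta0 acteta].
have equi a : 0 < a -> exists2 delta : R, 0 < delta &
    forall n, modulus_at (@inv_orbit (H n) x) a delta.
  by move=> /inv_orbit_equi[delta delta0 h]; exists delta.
(* Two sets of probability at least 3/4 must meet. *)
have k0 : 0 < 4^-1 :> R by lra.
have := lozenge_equi_unif_continuous levyH equi lozX k0 eta0.
apply: filterS => n /ereal_inf_lt[_ [Y0 [bY0 muY0] <-] Y0eta] h.
pose A : set (borel (csg_type d (H n))) := inv_orbit x @^-1` Y0.
have mA y : measurable (inv_orbit y @^-1` Y0 : set (borel (csg_type d (H n)))).
  exact: borel_preimage (@inv_orbit_continuous _ y) bY0.
pose hA : set (borel (csg_type d (H n))) := [set (h * g)%g | g in A].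
(* Writing the translate as a preimage of [Y0], with base point [h x], shows that it is
   measurable. *)
have hAE : hA = inv_orbit (inv_orbit x h^-1%g) @^-1` Y0.
  apply/seteqP; split=> [_ [g Ag <-]|g Yg].
    by rewrite /preimage/mkset -inv_orbit_mul mulKg.
  exists (h^-1 * g)%g; last exact: mulVKg.
  by rewrite /A /preimage/mkset inv_orbit_mul.
have mhA : measurable hA by rewrite hAE.
have [_ [[g Ag <-] Ahg]] : hA `&` A !=set0.
  apply: (measure_meet (mu := mu n)) => //; first exact: mA.
  rewrite [X in (_ < X + _)%E](muH h (mA x)).
  move: muY0; rewrite /mm_mass /= probability_setT.
  rewrite -(fineK (fin_num_measure (mu n) _ (mA x))).
  rewrite -EFinB -EFinD lte_fin lee_fin; lra.
have gYh : mdist (inv_orbit x g) (inv_orbit (inv_orbit x h) g) < eta.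
  rewrite -lte_fin; apply: le_lt_trans Y0eta; apply: mdist_le_diam => //.
  by rewrite -inv_orbit_mul.
(* Acting by [g] cancels [g^-1] in both points and leaves [x] and [h^-1 x]. *)
have := acteta (csg_val (d := d) g) _ _ gYh.
by rewrite /inv_orbit -!actM mulgV act1 mul1g.
Qed.

Hypothesis Hchain : forall n, H n `<=` H n.+1.

Lemma levy_action_fixed n (h : G) (x : X) : csg_set (H n) h -> act h x = x.
Proof.
move=> Hh; suff hx : mdist x (act h x) = 0 by have := mdist_positivity _ _ hx.
apply/eqP; rewrite eq_le mdist_ge0 andbT; apply/ler_addgt0Pl => e e0.
rewrite addr0.
have [N _ HN] := levy_action_almost_fixed x e0.
have Hhm m : (n <= m)%N -> csg_set (H m) h.
  by move=> /subnK <-; elim: (m - n)%N => [//|k]; rewrite addSn; exact: Hchain.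
(* The element supplied is the inverse of [h], since [inv_orbit] inverts it again. *)
have := HN (maxn n N) (leq_maxr _ _) (csg_elt d (csgV (Hhm _ (leq_maxl _ _)))).
by rewrite /inv_orbit /csg_val/= invgK => /ltW.
Qed.

Lemma levy_action_trivial (g : G) (x : X) :
  dense (\bigcup_n (H n : set G)) -> act g x = x.
Proof.
move=> Hdense.
suff gx : mdist x (act g x) = 0 by have := mdist_positivity _ _ gx.
apply/eqP; rewrite eq_le mdist_ge0 andbT; apply/ler_addgt0Pl => e e0.
rewrite addr0.
have [delta delta0 ddelta] := bounded_action_dist e0.
have : nbhs g [set h | d g h < delta] by rewrite (cdist_nbhs d); exists delta.
rewrite nbhsE => -[V [oV Vg] Vdelta].
have [h [/Vdelta gh [n _ Hh]]] := Hdense _ (ex_intro _ g Vg) oV.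
have := ddelta _ _ x gh.
(* As [h] fixes [x], the point [g h^-1 x] equals [g h^-1 (h x) = g x]. *)
by rewrite -[X in act _ X](levy_action_fixed x Hh) -actM mulgVK => /ltW.
Qed.

End OrbitMaps.

Theorem proposition4p4 (R : realType) (G : topologicalGroupType)
    (X : metricType R) (act : G -> X -> X) :
  levy_group R G -> lozenge X ->
  is_group_action act -> bounded_action act -> unif_equicontinuous_action act ->
  forall (g : G) (x : X), act g x = x.
Proof.
move=> [H [Hchain Hdense [d dinv [mu muH levyH]]]] lozX actG actb acte g x.
exact: (levy_action_trivial actG actb acte dinv muH levyH lozX Hchain).
Qed.
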